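(* Let $a$ be a weak composition with exactly two nonzero parts and at least two leading zeros (that is, $a_1=a_2=0$). Then $\kappa_a$ is multiplicity free if and only if either (1) $\mathrm{sort}(a)$ is one of the partitions $(3,3)$, $(4,4)$, $(n-2,2)$ for some $n\ge 4$, or $(n-1,1)$ for some $n\ge 2$; or (2) $\mathrm{flat}(a)=(4,3)$.
   Context: A weak composition $a=(a_1,\dots,a_\ell)$ of length $\ell$ is a finite sequence of nonnegative integers. $\mathrm{flat}(a)$ is the sequence obtained by deleting the zeros of $a$, and $\mathrm{sort}(a)$ is the partition obtained by rearranging the parts of $\mathrm{flat}(a)$ in weakly decreasing order. A diagram is a finite set of cells $(r,c)$ with $r,c$ positive integers (row $r$ from the bottom, column $c$ from the left). A Kohnert tableau of content $a$ is a diagram filled with positive integers, exactly $a_i$ cells containing $i$ for each $i$, such that: (i) for each $i$ there is exactly one $i$ in each of the columns $1,\dots,a_i$; (ii) every entry in row $r$ is at least $r$; (iii) for each $i$, the cells containing $i$ weakly descend from left to right; (iv) if $i<j$ appear in the same column with $i$ above $j$, then there is an $i$ in the column immediately to the right of the cell containing that $j$, in a row strictly above it. It is quasi-Yamanouchi if moreover (v) for each nonempty row $r$, either row $r$ contains an entry equal to $r$, or some cell of row $r+1$ lies weakly to the right of some cell of row $r$. Let $\mathrm{QKT}(a)$ be the set of quasi-Yamanouchi Kohnert tableaux of content $a$, and $\mathrm{wt}(T)$ the weak composition of length $\ell$ whose $r$-th part is the number of cells in row $r$ of $T$. The key polynomial $\kappa_a$ satisfies $\kappa_a=\sum_{T\in\mathrm{QKT}(a)}\mathfrak{F}_{\mathrm{wt}(T)}$,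 where $\mathfrak{F}_b$ is the fundamental slide polynomial. We say $\kappa_a$ is multiplicity free if distinct tableaux in $\mathrm{QKT}(a)$ have distinct weights. *)

(* Defs.v *)
From mathcomp Require Import all_boot finmap.

Set Implicit Arguments.
Unset Strict Implicit.
Unset Printing Implicit Defensive.

Local Open Scope fset_scope.

(* The list stores a_1, ..., a_l; trailing and internal zeros are significant. *)
Definition weak_composition := seq nat.

(* Parts are numbered from 1 and vanish beyond the length; [part a 0] is a junk
   value, so indices are required to be positive wherever [part] is used. *)
Definition part (a : weak_composition) (i : nat) : nat := nth 0 a i.-1.

Definition flat (a : weak_composition) : seq nat := [seq x <- a | x != 0].

Definition sort_parts (a : weak_composition) : seq nat := sort geq (flat a).

(* [T (r, c)] is the entry of the cell in row [r] (from the bottom) and column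
   [c] (from the left). Entries being positive, [T (r, c) = 0] means that
   [(r, c)] is not a cell, so the underlying diagram is [finsupp T] and two
   fillings are equal exactly when they have the same cells and entries. *)
Definition filling := {fsfun nat * nat -> nat with 0}.

Definition cells (T : filling) : {fset nat * nat} := finsupp T.

Record kohnert_tableau (a : weak_composition) (T : filling) : Prop := {
  cells_positive :
    forall r c, (r, c) \in cells T -> 0 < r /\ 0 < c;
  content :
    forall i, 0 < i -> #|` [fset x in cells T | T x == i]| = part a i;
  one_per_column :
    forall i c, 0 < i -> 0 < c -> c <= part a i -> exists! r, T (r, c) = i;
  entries_ge_row :
    forall r c, (r, c) \in cells T -> r <= T (r, c);
  weakly_descending :
    forall i r1 c1 r2 c2, 0 < i -> T (r1, c1) = i -> T (r2, c2) = i ->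
      c1 < c2 -> r2 <= r1;
  inversion_witness :
    forall i j ri rj c, 0 < i -> i < j ->
      T (ri, c) = i -> T (rj, c) = j -> rj < ri ->
      exists2 r, rj < r & T (r, c.+1) = i
}.

Definition quasi_yamanouchi (T : filling) : Prop :=
  forall r, (exists c, (r, c) \in cells T) ->
    (exists2 c, (r, c) \in cells T & T (r, c) = r) \/
    (exists c c', [/\ (r, c) \in cells T, (r.+1, c') \in cells T & c <= c']).

Definition QKT (a : weak_composition) (T : filling) : Prop :=
  kohnert_tableau a T /\ quasi_yamanouchi T.

(* The [r]-th part of the weight, [1 <= r <= l], counts the cells in row [r];
   for a Kohnert tableau of content [a] of length [l] there is no other row. *)
Definition wt (l : nat) (T : filling) : weak_composition :=
  [seq #|` [fset x in cells T | x.1 == r]| | r <- iota 1 l].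

(* Fundamental slide polynomials are linearly independent, so the coefficients
   of the key polynomial [kappa_a = \sum_(T in QKT a) F_(wt T)] are all 0 or 1
   exactly when this holds. *)
Definition key_multiplicity_free (a : weak_composition) : Prop :=
  forall S T : filling, QKT a S -> QKT a T -> S <> T ->
    wt (size a) S <> wt (size a) T.

(* Main.v *)
(** Let [p < q] be the two labels of [a], occurring [m] and [n] times. A
    Kohnert tableau is then a pair of weakly decreasing words, listing by
    column the rows of the [p]'s and of the [q]'s, and equal weights together
    with one equal word force the other word to be equal. Being
    quasi-Yamanouchi pins [p] in column 1 to row [p], leaves rows strictly
    between [p] and [q] empty, and makes every nonempty row below [p] contain
    a [p] with a [q] weakly to its right one row above, or the same with [p]
    and [q] exchanged; the latter forces an inversion (a [p] above the [q] of its column), and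
    inversions persist to
    the right. For [m <= 2] or [n <= 2] this leaves so few tableaux that the
    weight determines one of the words. In general the [p]'s occupy
    consecutive rows, so no tableau reaches below row [p - m], and the shapes
    (3,3), (4,4), (4,3) are settled by enumerating row offsets from [p]. All
    other shapes have two tableaux of equal weight using only rows [q], [p],
    [p - 1], [p - 2]; this is where two leading zeros are needed. *)
Require Import Defs.
From mathcomp Require Import all_boot finmap.
From mathcomp Require Import zify.

Set Implicit Arguments.
Unset Strict Implicit.
Unset Printing Implicit Defensive.

(** * Fillings as pairs of words *)

(* [nth 0 xs c] and [nth 0 ys c] are the rows of the [p] and of the [q] in column
   [c.+1]; rows being positive, the default [0] means that there is none. *)
Record kohnert_words (p q : nat) (xs ys : seq nat) : Prop := KohnertWords {
  kw_xpos : 0 \notin xs;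
  kw_ypos : 0 \notin ys;
  kw_xle : forall c, nth 0 xs c <= p;
  kw_yle : forall c, nth 0 ys c <= q;
  kw_xdec : forall c c', c <= c' -> nth 0 xs c' <= nth 0 xs c;
  kw_ydec : forall c c', c <= c' -> nth 0 ys c' <= nth 0 ys c;
  kw_disj : forall c, nth 0 xs c = nth 0 ys c -> nth 0 xs c = 0;
  kw_inv : forall c, 0 < nth 0 ys c -> nth 0 ys c < nth 0 xs c ->
    nth 0 ys c < nth 0 xs c.+1;
  kw_qy : forall r c, 0 < r -> nth 0 xs c = r \/ nth 0 ys c = r ->
    [\/ r = p /\ exists c1, nth 0 xs c1 = p,
        r = q /\ exists c1, nth 0 ys c1 = q |
        exists c1 c2, [/\ c1 <= c2, nth 0 xs c1 = r \/ nth 0 ys c1 = r &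
          nth 0 xs c2 = r.+1 \/ nth 0 ys c2 = r.+1]]
}.

(** Positivity of [r] discards the default [0] of [nth]; positivity of [c] keeps column 0 from being
    read as column 1, since [0.-1 = 0]. *)
Definition at_cell (s : seq nat) (r c : nat) : bool :=
  [&& 0 < r, 0 < c & nth 0 s c.-1 == r].

Record encodes (T : filling) (p q : nat) (xs ys : seq nat) : Prop := Encodes {
  enc_x : forall r c, (T (r, c) == p) = at_cell xs r c;
  enc_y : forall r c, (T (r, c) == q) = at_cell ys r c;
  enc_entry : forall rc, [|| T rc == 0, T rc == p | T rc == q]
}.

(** The filter [Q] lets one list serve two counts: [predT] for the content and [pred1 r] for the
    weight. *)
Definition cell_list (Q : pred nat) (s : seq nat) : seq (nat * nat) :=
  [seq (nth 0 s c, c.+1) | c <- iota 0 (size s) & Q (nth 0 s c)].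

Lemma cell_list_uniq Q s : uniq (cell_list Q s).
Proof.
by rewrite map_inj_uniq ?filter_uniq ?iota_uniq // => c c' [_ ->].
Qed.

Lemma size_cell_list Q s : size (cell_list Q s) = count Q s.
Proof.
rewrite size_map size_filter -[in RHS](mkseq_nth 0 s) /mkseq count_map.
exact: eq_count.
Qed.

Lemma mem_cell_list Q s r c : 0 \notin s ->
  ((r, c) \in cell_list Q s) = at_cell s r c && Q r.
Proof.
move=> s0; apply/mapP/idP => [[d]|].
  rewrite mem_filter mem_iota /= add0n => /andP[Qd ltd] [-> ->].
  rewrite /at_cell /= eqxx Qd !andbT lt0n; apply: contra s0 => /eqP <-.
  exact: mem_nth.
case/andP=> /and3P[r0 c0 /eqP er] Qr; exists c.-1; last by rewrite er prednK.
rewrite mem_filter er Qr mem_iota /= add0n.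
by case: ltnP => // le; move: r0; rewrite -er nth_default.
Qed.

Lemma encodes_inj T T' p q xs ys :
  encodes T p q xs ys -> encodes T' p q xs ys -> T = T'.
Proof.
move=> [xT yT eT] [xT' yT' eT']; apply/fsfunP => -[r c].
case hx: (at_cell xs r c).
  by have := xT r c; have := xT' r c; rewrite hx => /eqP -> /eqP ->.
case hy: (at_cell ys r c).
  by have := yT r c; have := yT' r c; rewrite hy => /eqP -> /eqP ->.
have := eT (r, c); have := eT' (r, c).
by rewrite xT yT xT' yT' hx hy !orbF => /eqP -> /eqP ->.
Qed.

Lemma card_row T p q xs ys r : 0 < p -> p < q -> 0 \notin xs -> 0 \notin ys ->
  encodes T p q xs ys ->
  #|` [fset x in cells T | x.1 == r]%fset| = count_mem r xs + count_mem r ys.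
Proof.
move=> p0 pq x0 y0 [xT yT eT]; rewrite -!size_cell_list -size_cat.
apply: perm_size; apply: uniq_perm; first exact: fset_uniq.
  rewrite cat_uniq !cell_list_uniq andbT /=; apply/hasPn => -[r1 c].
  rewrite !mem_cell_list // -xT -yT => /andP[/eqP -> _].
  by rewrite gtn_eqF.
move=> [r1 c]; rewrite mem_cat !mem_cell_list // -andb_orl -xT -yT.
rewrite !inE /= /cells mem_finsupp; congr (_ && _).
by case/or3P: (eT (r1, c)) => /eqP ->; rewrite ?eqxx ?orbT //; lia.
Qed.

Lemma wt_encodes T p q xs ys l : 0 < p -> p < q -> 0 \notin xs ->
  0 \notin ys -> encodes T p q xs ys ->
  wt l T = [seq count_mem r xs + count_mem r ys | r <- iota 1 l].
Proof. by move=> *; apply: eq_map => r; apply: card_row; eauto. Qed.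

Lemma encodes_ex p q xs ys : 0 < p -> p < q -> kohnert_words p q xs ys ->
  exists T, encodes T p q xs ys.
Proof.
move=> p0 pq kw.
pose f (rc : nat * nat) :=
  if at_cell xs rc.1 rc.2 then p else if at_cell ys rc.1 rc.2 then q else 0.
pose D := [fset rc in cell_list predT xs ++ cell_list predT ys]%fset.
pose T : filling := [fsfun rc in D => f rc]%fset.
have TE rc : T rc = f rc.
  rewrite fsfunE; case: ifP => //; case: rc => r c.
  rewrite in_fset /= mem_cat !mem_cell_list ?(kw_xpos kw) ?(kw_ypos kw) // !andbT => /negbT.
  by rewrite /f /=; case/norP => /negbTE -> /negbTE ->.
exists T; split=> [r c|r c|rc]; rewrite TE /f /=.
- by case: ifP => _; [rewrite eqxx | case: ifP => _; lia].
- case: ifP => hx; last by case: ifP => _; lia.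
  rewrite ltn_eqF //; apply/esym/negbTE/negP => hy.
  have := kw_disj kw (c := c.-1).
  by case/and3P: hx hy => r0 _ /eqP -> /and3P[_ _ /eqP ->] /(_ erefl); lia.
- by case: ifP => _; [|case: ifP => _]; rewrite eqxx ?orbT.
Qed.

Lemma encodes_cells T p q xs ys : 0 < p -> p < q -> encodes T p q xs ys ->
  forall r c, ((r, c) \in cells T) = at_cell xs r c || at_cell ys r c.
Proof.
move=> p0 pq [xT yT eT] r c; rewrite /cells mem_finsupp -xT -yT.
by have := eT (r, c); lia.
Qed.

(** * Tableaux and their words *)

Lemma at_cellP s r c : reflect (0 < r /\ nth 0 s c = r) (at_cell s r c.+1).
Proof.
by rewrite /at_cell /=; apply: (iffP andP) => -[-> /eqP].
Qed.

Lemma at_cell_pos s r c : at_cell s r c -> 0 < c.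
Proof. by case/and3P. Qed.

(** Choosing the cell given by [one_per_column] in each of the first [part a i] columns builds the
    word; [content] then leaves room for no further cell with entry [i]. *)
Lemma column_word a T i : 0 < i -> kohnert_tableau a T ->
  exists s, [/\ size s = part a i, 0 \notin s &
    forall r c, (T (r, c) == i) = at_cell s r c].
Proof.
move=> i0 kt.
have [s [sz hs]] : exists s, size s = part a i /\
    forall c, c < size s -> T (nth 0 s c, c.+1) = i.
  move: (leqnn (part a i)); elim: {1 3}(part a i) => [|k IH] le.
    by exists [::].
  have [s [sz hs]] := IH (ltnW le).
  have [r [Tr _]] := one_per_column kt i0 (isT : 0 < k.+1) le.
  exists (rcons s r); rewrite size_rcons sz; split=> // c; rewrite ltnS nth_rcons sz.
  case: ltngtP => // [lt|->] _; last by [].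
  by apply: hs; rewrite sz.
have cellT rc : T rc = i -> rc \in cells T.
  by move=> e; rewrite /cells mem_finsupp e -lt0n.
have s0 : 0 \notin s.
  apply/negP => /(nthP 0) [c lt e]; have := hs c lt.
  by move/cellT/(cells_positive kt); rewrite e; case.
exists s; split=> // r c.
pose A := [fset x in cells T | T x == i]%fset.
have [_ /(_ (r, c))] : (size (cell_list predT s) = size (enum_fset A)) *
    (cell_list predT s =i enum_fset A).
  apply: uniq_min_size; first exact: cell_list_uniq.
    move=> [r1 c1]; rewrite mem_cell_list // andbT.
    case: c1 => [/at_cell_pos //|c1] /at_cellP [r0 e].
    have lt : c1 < size s by rewrite ltnNge; apply/negP => ?; move: r0; rewrite -e nth_default.
    have := hs _ lt; rewrite e => eT.
    by rewrite !inE /= eT eqxx andbT; apply: cellT.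
  by rewrite size_cell_list count_predT sz -(content kt i0).
rewrite mem_cell_list // andbT => ->; rewrite !inE /=.
by case: eqP => [/cellT ->|]; rewrite ?andbF.
Qed.

Lemma nth_word_pos s c : 0 \notin s -> (0 < nth 0 s c) = (c < size s).
Proof.
move=> s0; case: (ltnP c (size s)) => le; last by rewrite nth_default.
by rewrite lt0n; apply: contra s0 => /eqP <-; apply: mem_nth.
Qed.

Lemma at_nth s c : 0 < nth 0 s c -> at_cell s (nth 0 s c) c.+1.
Proof. by move=> h; apply/at_cellP. Qed.

Lemma words_of_QKT a T p q : 0 < p -> p < q ->
  (forall i, 0 < i -> i != p -> i != q -> part a i = 0) -> QKT a T ->
  exists xs ys, [/\ size xs = part a p, size ys = part a q,
    encodes T p q xs ys & kohnert_words p q xs ys].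
Proof.
move=> p0 pq a0 [kt qy].
have q0 : 0 < q by apply: leq_trans pq.
have [xs [szx x0 xT]] := column_word p0 kt.
have [ys [szy y0 yT]] := column_word q0 kt.
have eT rc : [|| T rc == 0, T rc == p | T rc == q].
  apply/negPn/negP; rewrite !negb_or => /and3P[n0 np nq].
  have := content kt (i := T rc); rewrite lt0n n0 a0 ?lt0n // => /(_ isT).
  move/cardfs0_eq/fsetP/(_ rc); rewrite !inE /= eqxx andbT /cells.
  by rewrite mem_finsupp n0.
have enc : encodes T p q xs ys by split.
have cellE := encodes_cells p0 pq enc.
exists xs, ys; split=> //.
have dec i s : 0 < i -> 0 \notin s -> (forall r c, (T (r, c) == i) = at_cell s r c) ->
    forall c c', c <= c' -> nth 0 s c' <= nth 0 s c.
  move=> i0 s0 sT c c'; rewrite leq_eqVlt => /orP [/eqP -> //|lt].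
  case: (posnP (nth 0 s c')) => [-> //|c'0].
  have c0 : 0 < nth 0 s c.
    by move: c'0; rewrite !nth_word_pos //; apply: ltn_trans.

  by apply: (weakly_descending kt i0 (c1 := c.+1) (c2 := c'.+1)) => //;
    apply/eqP; rewrite sT at_nth.
have le i s : (forall r c, (T (r, c) == i) = at_cell s r c) ->
    (forall r c, at_cell s r c -> (r, c) \in cells T) ->
    forall c, nth 0 s c <= i.
  move=> sT sc c; case: (posnP (nth 0 s c)) => [-> //|c0].
  have h := at_nth c0; have := entries_ge_row kt (sc _ _ h).
  by rewrite -sT in h; rewrite (eqP h).
split=> //.
- by apply: (le _ _ xT) => r c h; rewrite cellE h.
- by apply: (le _ _ yT) => r c h; rewrite cellE h orbT.
- exact: (dec p).
- exact: (dec q).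
- move=> c e; case: (posnP (nth 0 xs c)) => // c0.
  have h1 := at_nth c0; have h2 : at_cell ys (nth 0 xs c) c.+1.
    by rewrite e; apply: at_nth; rewrite -e.
  by move: h1 h2; rewrite -xT -yT => /eqP ->; rewrite ltn_eqF.
- move=> c yc lt.
  have h1 := at_nth yc; have h2 := at_nth (leq_ltn_trans (leq0n _) lt).
  move: h1 h2; rewrite -xT -yT => /eqP h1 /eqP h2.
  have [r lr] := inversion_witness kt p0 pq h2 h1 lt.
  by move/eqP; rewrite xT => /at_cellP [_ ->].
- have cellP r c : (r, c) \in cells T -> 0 < c /\
      (nth 0 xs c.-1 = r \/ nth 0 ys c.-1 = r).
    by rewrite cellE => /orP[] /and3P[_ -> /eqP]; auto.
  have cellI r c : 0 < r -> nth 0 xs c = r \/ nth 0 ys c = r ->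
      (r, c.+1) \in cells T.
    by move=> r0 [] e; rewrite cellE -e at_nth ?orbT ?e.
  move=> r c r0 hc; have [|[d rd Tr]|] := qy r.
  + by exists c.+1; apply: cellI.
  + have [d0 _] := cellP _ _ rd.
    move: rd; rewrite cellE -xT -yT Tr => /orP[] /eqP er.
    * constructor 1; split=> //; exists d.-1.
      by move/eqP: Tr; rewrite {2}er xT => /and3P[_ _ /eqP ->].
    * constructor 2; split=> //; exists d.-1.
      by move/eqP: Tr; rewrite {2}er yT => /and3P[_ _ /eqP ->].
  + case=> d [d' [/cellP [d0 h] /cellP [d'0 h'] led]].
    constructor 3; exists d.-1, d'.-1; split=> //.
    by rewrite -ltnS !prednK.
Qed.

Lemma QKT_of_words a T p q xs ys : 0 < p -> p < q ->
  (forall i, 0 < i -> i != p -> i != q -> part a i = 0) ->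
  size xs = part a p -> size ys = part a q ->
  encodes T p q xs ys -> kohnert_words p q xs ys -> QKT a T.
Proof.
move=> p0 pq a0 szx szy enc kw.
have q0 : 0 < q by apply: leq_trans pq.
have cellE := encodes_cells p0 pq enc.
have [xT yT eT] := enc.
have x0 := kw_xpos kw; have y0 := kw_ypos kw.
(* Labels other than [p] and [q] get the empty word, so that all labels can be treated alike. *)
have word i : 0 < i -> exists s, [/\ 0 \notin s, size s = part a i,
    forall c c', c <= c' -> nth 0 s c' <= nth 0 s c &
    forall r c, (T (r, c) == i) = at_cell s r c].
  move=> i0; have [->|ip] := eqVneq i p; first by exists xs; split=> //; case: kw.
  have [->|iq] := eqVneq i q; first by exists ys; split=> //; case: kw.
  exists [::]; split=> //; first by rewrite a0.
    by move=> c c' _; rewrite !nth_nil.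
  move=> r c; have -> : at_cell [::] r c = false.
    by rewrite /at_cell nth_nil; lia.
  apply/negbTE/eqP => e; have := eT (r, c).
  by rewrite e (negbTE ip) (negbTE iq) eqn0Ngt i0.
split; first split.
- by move=> r c; rewrite cellE => /orP[] /and3P[].
- move=> i i0; have := word i i0 => -[s [s0 <- _ sT]].
  rewrite -[RHS]count_predT -size_cell_list; apply: perm_size.
  apply: uniq_perm; rewrite ?fset_uniq ?cell_list_uniq // => -[r c].
  rewrite mem_cell_list // andbT -sT !inE /= /cells mem_finsupp.
  by have [->|_] := eqVneq (T (r, c)) i; rewrite ?andbF // -lt0n i0.
- move=> i [//|c] i0 _ le; have [s [s0 sz _ sT]] := word i i0.
  exists (nth 0 s c); split.
    by apply/eqP; rewrite sT at_nth // nth_word_pos // sz.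
  by move=> r /eqP; rewrite sT => /at_cellP [].
- move=> r c; rewrite cellE => /orP[] h.
    have /eqP -> : T (r, c) == p by rewrite xT.
    by case/and3P: h => _ _ /eqP <-; apply: kw_xle kw _.
  have /eqP -> : T (r, c) == q by rewrite yT.
  by case/and3P: h => _ _ /eqP <-; apply: kw_yle kw _.
- move=> i r1 c1 r2 c2 i0 /eqP + /eqP; have [s [_ _ dec sT]] := word i i0.
  rewrite !sT => /and3P[_ c10 /eqP <-] /and3P[_ _ /eqP <-] lt.
  by apply: dec; lia.
- move=> i j ri rj c i0 ij Ti Tj lt.
  have [eip ejq] : i = p /\ j = q.
    by have := eT (ri, c); have := eT (rj, c); rewrite Ti Tj; lia.
  move/eqP: Tj; move/eqP: Ti; rewrite eip ejq xT yT.
  case: c => [/at_cell_pos //|c] /at_cellP [ri0 ei] /at_cellP [rj0 ej].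
  have := kw_inv kw (c := c); rewrite ei ej => /(_ rj0 lt) h.
  exists (nth 0 xs c.+1) => //; apply/eqP; rewrite xT; apply: at_nth.
  exact: leq_ltn_trans h.
- move=> r [c]; rewrite cellE => hc.
  have cellI r' c' : 0 < r' -> nth 0 xs c' = r' \/ nth 0 ys c' = r' ->
      (r', c'.+1) \in cells T.
    by move=> r0 [] e; rewrite cellE -e at_nth ?orbT ?e.
  have [r0 h] : 0 < r /\ (nth 0 xs c.-1 = r \/ nth 0 ys c.-1 = r).
    by case/orP: hc => /and3P[-> _ /eqP ->]; auto.
  case: (kw_qy kw r0 h) => [[er [d ed]]|[er [d ed]]|[d [d' [le h1 h2]]]].
  + left; exists d.+1; first by apply: cellI; rewrite // er; auto.
    by rewrite er; apply/eqP; rewrite xT -ed at_nth // ed.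
  + left; exists d.+1; first by apply: cellI; rewrite // er; auto.
    by rewrite er; apply/eqP; rewrite yT -ed at_nth // ed.
  + by right; exists d.+1, d'.+1; split=> //; apply: cellI.
Qed.

(** * Compositions with two nonzero parts *)

Lemma first_part a x s : flat a = x :: s ->
  exists k b, [/\ a = nseq k 0 ++ x :: b, 0 < x & flat b = s].
Proof.
elim: a => //= y a IH; rewrite /flat /=; case: eqP => [-> /=|/eqP y0 /= [<- <-]].
  by case/IH => k [b [-> x0 hb]]; exists k.+1, b.
by exists 0, a; rewrite lt0n.
Qed.

Lemma part_lead k x b i : 0 < i -> part (nseq k 0 ++ x :: b) i =
  if i <= k then 0 else if i == k.+1 then x else part b (i - k.+1).
Proof.
case: i => // i _; rewrite /part /= nth_cat size_nseq eqSS.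
case: ltnP => [lt|le]; first by rewrite nth_nseq lt.
rewrite subSS; have [->|ne] := eqVneq i k; first by rewrite subnn.
have lt : k < i by rewrite ltn_neqAle eq_sym ne.
by rewrite (_ : i - k = (i - k).-1.+1) //; lia.
Qed.

Lemma flat_nil_part b i : flat b = [::] -> part b i = 0.
Proof.
rewrite /part; move: i.-1 => {}i; elim: b i => [|y b IH] [|i] //=;
  by rewrite /flat /=; case: eqP => // _; apply: IH.
Qed.

Lemma two_parts a : size (flat a) = 2 -> part a 1 = 0 -> part a 2 = 0 ->
  exists p q, [/\ 2 < p, p < q & q <= size a] /\
    [/\ 0 < part a p, 0 < part a q, flat a = [:: part a p; part a q] &
      forall i, 0 < i -> i != p -> i != q -> part a i = 0].
Proof.
case E: (flat a) => [|m [|n []]] // _.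
have [k [b [-> m0 /first_part [l [b' [-> n0 hb']]]]]] := first_part E.
rewrite (@part_lead k m _ 1) // (@part_lead k m _ 2) // => e1 e2.
(* The two leading zeros make [p] at least 3, so that rows [p], [p - 1] and [p - 2] all exist. *)
have k1 : 1 < k by case: k e1 e2 => [|[|k]] //= e1 e2; lia.
exists k.+1, (k + l).+2.
have -> : part (nseq k 0 ++ m :: nseq l 0 ++ n :: b') k.+1 = m.
  by rewrite part_lead // ltnn eqxx.
have e : (k + l).+2 - k.+1 = l.+1 by lia.
have -> : part (nseq k 0 ++ m :: nseq l 0 ++ n :: b') (k + l).+2 = n.
  rewrite part_lead // e part_lead // ltnn eqxx !ifF //; lia.
split; split=> //; [lia| |].
- by rewrite !size_cat /= size_cat !size_nseq /=; lia.
- move=> i i0 ik il; rewrite part_lead // (negbTE ik).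
  case: leqP => // lt; rewrite part_lead; last by lia.
  case: leqP => // lt'; rewrite ifF; first exact: flat_nil_part.
  by lia.
Qed.

(** Tableaux and words determine each other. That [wt] sees only rows 1 to [size a] loses nothing:
    words avoid row 0 and never exceed [q <= size a]. *)
Lemma mult_free_words a p q : 0 < p -> p < q -> q <= size a ->
  (forall i, 0 < i -> i != p -> i != q -> part a i = 0) ->
  key_multiplicity_free a <->
  forall xs ys xs' ys', size xs = part a p -> size ys = part a q ->
    size xs' = part a p -> size ys' = part a q ->
    kohnert_words p q xs ys -> kohnert_words p q xs' ys' ->
    (forall r, count_mem r xs + count_mem r ys =
               count_mem r xs' + count_mem r ys') ->
    xs = xs' /\ ys = ys'.
Proof.
move=> p0 pq qa a0; split=> [free|free].
  move=> xs ys xs' ys' szx szy szx' szy' kw kw' eqw.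
  have [T enc] := encodes_ex p0 pq kw; have [T' enc'] := encodes_ex p0 pq kw'.
  have qT := QKT_of_words p0 pq a0 szx szy enc kw.
  have qT' := QKT_of_words p0 pq a0 szx' szy' enc' kw'.
  have eT : T = T'.
    apply/eqP/negPn/negP => /eqP ne; apply: (free _ _ qT qT' ne).
    rewrite (wt_encodes _ p0 pq (kw_xpos kw) (kw_ypos kw) enc).
    rewrite (wt_encodes _ p0 pq (kw_xpos kw') (kw_ypos kw') enc').
    by apply: eq_map => r; apply: eqw.
  have word i s s' : (forall r c, (T (r, c) == i) = at_cell s r c) ->
      (forall r c, (T' (r, c) == i) = at_cell s' r c) -> size s = size s' ->
      0 \notin s -> s = s'.
    move=> sT sT' sz s0; apply: (@eq_from_nth _ 0) => // c lt.
    have : at_cell s (nth 0 s c) c.+1 by rewrite at_nth // nth_word_pos.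
    by rewrite -sT eT sT' => /at_cellP [].
  case: enc enc' => xT yT _ [xT' yT' _].
  by split; [apply: (word p) | apply: (word q)] => //;
    rewrite ?szx ?szy ?(kw_xpos kw) ?(kw_ypos kw).
move=> S T qS qT ne ewt; apply: ne.
have [xs [ys [szx szy enc kw]]] := words_of_QKT p0 pq a0 qS.
have [xs' [ys' [szx' szy' enc' kw']]] := words_of_QKT p0 pq a0 qT.
suff [ex ey] : xs = xs' /\ ys = ys'.
  by apply: (encodes_inj enc); rewrite ex ey.
apply: free => // r.
case: (posnP r) => [->|r0].
  by rewrite !(count_memPn _) ?(kw_xpos kw) ?(kw_ypos kw) ?(kw_xpos kw') ?(kw_ypos kw').
case: (leqP r q) => [le|lt]; last first.
  have notin s : (forall c, nth 0 s c <= q) -> count_mem r s = 0.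
    move=> h; apply/count_memPn/negP => /(nthP 0) [c _ e].
    by have := h c; rewrite e leqNgt lt.
  have xle s : (forall c, nth 0 s c <= p) -> forall c, nth 0 s c <= q.
    by move=> h c; apply: leq_trans (h c) (ltnW pq).
  rewrite (notin xs) ?(notin xs') ?(notin ys) ?(notin ys') //;
    by [apply: kw_yle kw | apply: kw_yle kw' | apply/xle/(kw_xle kw) | apply/xle/(kw_xle kw')].
move: ewt.
rewrite (wt_encodes _ p0 pq (kw_xpos kw) (kw_ypos kw) enc).
rewrite (wt_encodes _ p0 pq (kw_xpos kw') (kw_ypos kw') enc').
by move/eq_in_map; apply; rewrite mem_iota; lia.
Qed.

(** * Constraints on the rows of the two words *)

(** A [q] in a row strictly between [p] and [q] would need a cell one row higher and weakly to the
    right of a cell of its row. All [p]'s are too low for that, and the [q]'s descend. *)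
Lemma kw_y_cases p q xs ys c : kohnert_words p q xs ys ->
  nth 0 ys c <= p \/ nth 0 ys c = q.
Proof.
move=> kw; case: (leqP (nth 0 ys c) p) => [|lt]; [by left | right].
have [[e _]|[-> _] //|[c1 [c2 [le h1 h2]]]] :=
  kw_qy kw (leq_ltn_trans (leq0n _) lt) (or_intror erefl); first by lia.
have := kw_ydec kw le; have := kw_xle kw c1; have := kw_xle kw c2; lia.
Qed.

(** Two cells with the same label cannot serve in the quasi-Yamanouchi condition, since each word
    descends. *)
Lemma kw_low p q xs ys r c : p < q -> kohnert_words p q xs ys -> 0 < r ->
  r < p -> nth 0 xs c = r \/ nth 0 ys c = r ->
  (exists c1 c2, [/\ c1 <= c2, nth 0 xs c1 = r & nth 0 ys c2 = r.+1]) \/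
  (exists c1 c2, [/\ c1 <= c2, nth 0 ys c1 = r & nth 0 xs c2 = r.+1]).
Proof.
move=> pq kw r0 rp h.
have [[e _]|[e _]|[c1 [c2 [le h1 h2]]]] := kw_qy kw r0 h; [lia | lia |].
have := kw_ydec kw le; have := kw_xdec kw le.
case: h1 h2 => h1 [] h2; [lia | by left; exists c1, c2 | | lia].
by right; exists c1, c2.
Qed.

(** Below [p], a nonempty row has a nonempty row above it, so climbing from the first [p] shows that
    row [p] is nonempty. A [q] there cannot justify the row, as nothing in row [p + 1] lies to its
    right; hence row [p] contains a [p], and by descent so does its column 1. *)
Lemma kw_x0 p q xs ys : 0 < p -> p < q -> 0 < size xs ->
  kohnert_words p q xs ys -> nth 0 xs 0 = p.
Proof.
move=> p0 pq sx kw.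
have up k : forall r, p = r + k -> 0 < r ->
    (exists c, nth 0 xs c = r \/ nth 0 ys c = r) ->
    exists c, nth 0 xs c = p \/ nth 0 ys c = p.
  elim: k => [|k IH] r e r0 [c h]; first by exists c; rewrite e addn0.
  apply: (IH r.+1) => //; first by rewrite e addnS.
  have rp : r < p by rewrite e addnS ltnS leq_addr.
  by case: (kw_low pq kw r0 rp h) => -[_ [d [_ _ hd]]]; exists d; auto.
have x0 : 0 < nth 0 xs 0 by rewrite nth_word_pos ?(kw_xpos kw).
have [|//||c hc] := up (p - nth 0 xs 0) (nth 0 xs 0).
- by rewrite subnKC // (kw_xle kw).
- by exists 0; left.
have [c1 e1] : exists c1, nth 0 xs c1 = p.
  have [[_ //]|[e _]|[c1 [c2 [le h1 h2]]]] := kw_qy kw p0 hc; first by lia.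
  have := kw_ydec kw le; have := kw_xle kw c2.
  by case: h1 => h1; [exists c1 | lia].
by have := kw_xdec kw (leq0n c1); have := kw_xle kw 0; lia.
Qed.

(** The witness of an inversion is a [p] in the next column above the current [q], hence above the
    next [q] too: the next column is again inverted. *)
Lemma kw_inv_right p q xs ys c d : kohnert_words p q xs ys ->
  nth 0 ys c < nth 0 xs c -> c <= d -> 0 < nth 0 ys d ->
  nth 0 ys d < nth 0 xs d.+1.
Proof.
move=> kw + /subnKC <-; elim: (d - c) => [|k IH] lt.
  by rewrite addn0 => y0; exact: (kw_inv kw y0 lt).
rewrite addnS => y0; apply: (kw_inv kw y0).
have le := kw_ydec kw (leqnSn (c + k)).
exact: leq_ltn_trans le (IH lt (leq_trans y0 le)).
Qed.

(** An inversion would persist to the last column of the [p]'s, which still holds a [q], and there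
    demand one more [p]. *)
Lemma kw_noinv p q xs ys c : kohnert_words p q xs ys -> size xs <= size ys ->
  nth 0 xs c <= nth 0 ys c.
Proof.
move=> kw le; rewrite leqNgt; apply/negP => lt.
have lc : c < size xs.
  by rewrite -nth_word_pos ?(kw_xpos kw) //; apply: leq_ltn_trans lt.
have le1 : c <= (size xs).-1 by lia.
have := kw_inv_right kw lt le1; rewrite nth_word_pos ?(kw_ypos kw) //.
have lt2 : (size xs).-1 < size ys by lia.
by move/(_ lt2); rewrite [nth 0 xs _]nth_default //; lia.
Qed.

Lemma eq_of_count s s' :
  (forall c c', c <= c' -> nth 0 s c' <= nth 0 s c) ->
  (forall c c', c <= c' -> nth 0 s' c' <= nth 0 s' c) ->
  (forall r, count_mem r s = count_mem r s') -> s = s'.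
Proof.
move=> ds ds' e; apply: (@sorted_eq _ geq).
- by move=> x y z h1 h2; apply: leq_trans h2 h1.
- by move=> x y /andP[h1 h2]; apply/eqP; rewrite eqn_leq; apply/andP.
- by apply/(sortedP 0) => i _; apply: ds.
- by apply/(sortedP 0) => i _; apply: ds'.
- by apply/allP => x _ /=; apply/eqP.
Qed.

Definition same_weight (xs ys xs' ys' : seq nat) : Prop :=
  forall r, count_mem r xs + count_mem r ys =
            count_mem r xs' + count_mem r ys'.

Lemma same_weight_x p q xs ys xs' ys' : kohnert_words p q xs ys ->
  kohnert_words p q xs' ys' -> same_weight xs ys xs' ys' -> xs = xs' ->
  xs = xs' /\ ys = ys'.
Proof.
move=> kw kw' sw e; split=> //; apply: eq_of_count.
- exact: kw_ydec kw.
- exact: kw_ydec kw'.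
- by move=> r; have := sw r; rewrite e => /addnI.
Qed.

Lemma same_weight_y p q xs ys xs' ys' : kohnert_words p q xs ys ->
  kohnert_words p q xs' ys' -> same_weight xs ys xs' ys' -> ys = ys' ->
  xs = xs' /\ ys = ys'.
Proof.
move=> kw kw' sw e; split=> //; apply: eq_of_count.
- exact: kw_xdec kw.
- exact: kw_xdec kw'.
- by move=> r; have := sw r; rewrite e => /addIn.
Qed.

Lemma count_gt r s : (forall c, nth 0 s c < r) -> count_mem r s = 0.
Proof.
by move=> h; apply/count_memPn/negP => /(nthP 0) [c _ e]; have := h c; rewrite e ltnn.
Qed.

Lemma kw_count_q p q xs ys : p < q -> kohnert_words p q xs ys ->
  count_mem q xs = 0.
Proof. by move=> pq kw; apply: count_gt => c; apply: leq_ltn_trans (kw_xle kw c) pq. Qed.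

(** * Words of length at most two *)

Definition determined (p q m n : nat) : Prop :=
  forall xs ys xs' ys', size xs = m -> size ys = n ->
    size xs' = m -> size ys' = n ->
    kohnert_words p q xs ys -> kohnert_words p q xs' ys' ->
    same_weight xs ys xs' ys' -> xs = xs' /\ ys = ys'.

Lemma determined_x1 p q n : 0 < p -> p < q -> determined p q 1 n.
Proof.
move=> p0 pq [|x []] // ys [|x' []] // ys' _ _ _ _ kw kw' sw.
apply: (same_weight_x kw kw' sw).
by have := kw_x0 p0 pq _ kw; have := kw_x0 p0 pq _ kw'; move=> /= -> // -> .
Qed.

(** Every nonempty row below [p] needs a [q] in itself or in the row above. If the only [q] were
    below row [p - 1], a [p] would sit just above it, in a row that has no such [q]. *)
Lemma kw_y1 p q xs y : 0 < p -> p < q -> 0 < size xs ->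
  kohnert_words p q xs [:: y] -> y = q \/ y.+1 = p.
Proof.
move=> p0 pq sx kw; have /= x0 := kw_x0 p0 pq sx kw.
have y0 : 0 < y by have := kw_ypos kw; rewrite inE; lia.
have [/= le|/= ?] := kw_y_cases 0 kw; [right | by left].
have ne : y <> p by have := kw_disj kw (c := 0); rewrite /= x0; lia.
have nthy c r : nth 0 [:: y] c = r.+1 -> r.+1 = y.
  by case: c => [|c] //=; rewrite nth_nil.
have [| |d1|d2] := @kw_low p q xs [:: y] y 0 pq kw y0; first by lia.
- by right.
- by case: d1 => c1 [c2 [_ _ /nthy]]; lia.
case: d2 => c1 [c2 [_ _ e]].
case: (ltnP y.+1 p) => [lt|]; last by lia.
have [[d1 [d2 [_ _ /nthy]]]|[d1 [d2 [_ /nthy]]]] :=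
  kw_low pq kw (ltn0Sn y) lt (or_introl e); lia.
Qed.

Lemma determined_y1 p q m : 0 < p -> p < q -> 0 < m -> determined p q m 1.
Proof.
move=> p0 pq m0 xs [|y []] // xs' [|y' []] // szx _ szx' _ kw kw' sw.
apply: (same_weight_y kw kw' sw).
have := sw q; rewrite (kw_count_q pq kw) (kw_count_q pq kw') /=.
have := kw_y1 p0 pq _ kw; have := kw_y1 p0 pq _ kw'.
rewrite szx szx' => /(_ m0) h' /(_ m0) h e; congr (_ :: _); lia.
Qed.

(** If the second [p] were below row [p - 1], the quasi-Yamanouchi condition would put a [q] below
    row [p] in column 1, an inversion that [kw_noinv] excludes. *)
Lemma kw_x2 p q x y ys : 0 < p -> p < q -> 1 < size ys ->
  kohnert_words p q [:: x; y] ys -> x = p /\ (y = p \/ y.+1 = p).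
Proof.
move=> p0 pq sy kw; have /= x0 := kw_x0 p0 pq (isT : 0 < size [:: x; y]) kw; split=> //.
have y0 : 0 < y by have := kw_xpos kw; rewrite !inE; lia.
have le : y <= p := kw_xle kw 1.
have noinv c := kw_noinv c kw sy.
have nthx c r : nth 0 [:: x; y] c = r.+1 -> c = 0 /\ r.+1 = p \/ c = 1 /\ r.+1 = y.
  by case: c => [|[|c]] //=; rewrite ?nth_nil //; lia.
case: (ltngtP y.+1 p) => [lt||]; [|by lia | by auto].
have [[c1 [c2 [_ _ e]]]|[c1 [c2 [l e /nthx h]]]] := @kw_low p q _ ys y 1 pq kw y0 (ltnW lt) (or_introl erefl).
  have [[d1 [d2 [_ /nthx h]]]|[d1 [d2 [l e' /nthx h]]]] := kw_low pq kw (ltn0Sn y) lt (or_intror e).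
    by lia.
  have d0 : d1 = 0 by lia.
  by have := noinv d1; rewrite e' d0 /=; lia.
have c0 : c1 = 0 by lia.
by have := noinv c1; rewrite e c0 /=; lia.
Qed.

(** The weight of row [p - 1] decides between the two cases of [kw_x2]: with both [p]'s in row [p],
    a [q] in row [p - 1] would create an inversion, so that row is empty. *)
Lemma determined_x2 p q n : 1 < p -> p < q -> 1 < n -> determined p q 2 n.
Proof.
move=> p1 pq n1.
have p0 := ltnW p1.
have excl ys y' ys' : 1 < size ys -> kohnert_words p q [:: p; p] ys ->
    y'.+1 = p -> same_weight [:: p; p] ys [:: p; y'] ys' -> False.
  move=> sy kw e sw; have y0 : 0 < y' by lia.
  have : y' \in ys.
    by rewrite -has_pred1 has_count; have := sw y'; rewrite /= eqxx; lia.
  case/(nthP 0) => c _ ec.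
  have [[c1 [c2 [_ h _]]]|[c1 [c2 [l h1 h2]]]] :=
    @kw_low p q _ ys y' c pq kw y0 (eq_leq e) (or_intror ec).
    by case: c1 h => [|[|c1]] /=; rewrite ?nth_nil; lia.
  have := kw_noinv c1 kw sy; rewrite h1.
  case: c2 l h2 => [|[|c2]] l /=; rewrite ?nth_nil // => _; case: c1 l {h1} => [|[|c1]] //=; lia.
move=> [|x [|y []]] // ys [|x' [|y' []]] // ys' _ szy _ szy' kw kw' sw.
apply: (same_weight_x kw kw' sw).
rewrite -szy in n1; have [ex ey] := kw_x2 p0 pq n1 kw.
rewrite szy -szy' in n1; have [ex' ey'] := kw_x2 p0 pq n1 kw'.
subst x x'; congr [:: _; _]; case: ey ey' => [e|e] [e'|e']; try lia.
  rewrite e in kw sw; case: (excl ys y' ys') => //; lia.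
rewrite e' in kw' sw; by case: (excl ys' y ys).
Qed.

(** The first [q] is in row [q] or below the [p] of its column; in the latter case the inversion
    reaches column 2. Each nonempty row below [p] needs a [q] in itself or just above, so two [q]'s
    cannot lie far below [p]. *)
Lemma kw_y2 p q xs y z : 0 < p -> p < q -> 0 < size xs ->
  kohnert_words p q xs [:: y; z] ->
  [\/ y = q /\ z = q,
      [/\ y = q, z = p & nth 0 xs 1 < p],
      [/\ y = q, z.+1 = p, nth 0 xs 1 = p & nth 0 xs 2 = p] |
      [/\ y.+1 = p, z.+1 = p & nth 0 xs 2 = p] \/
      y.+1 = p /\ z.+2 = p].
Proof.
move=> p0 pq sx kw; have x0 := kw_x0 p0 pq sx kw.
have y0 : 0 < y by have := kw_ypos kw; rewrite !inE; lia.
have z0 : 0 < z by have := kw_ypos kw; rewrite !inE; lia.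
have zy : z <= y := kw_ydec kw (leqnSn 0).
have nthy c r : nth 0 [:: y; z] c = r.+1 ->
    c = 0 /\ r.+1 = y \/ c = 1 /\ r.+1 = z.
  by case: c => [|[|c]] //=; rewrite ?nth_nil //; lia.
(* This is [kw_low] with the column of the [q] read off from the two-letter word; [c <= 1] and
   [0 < c] keep the order of the columns. *)
have low r : 0 < r -> r < p -> r = y \/ r = z \/ (exists c, nth 0 xs c = r) ->
  (exists c, nth 0 xs c = r /\ (c = 0 /\ r.+1 = y \/ c <= 1 /\ r.+1 = z)) \/
  (exists2 c, nth 0 xs c = r.+1 & r = y \/ 0 < c /\ r = z).
  move=> r0 rp hr.
  have [c hc] : exists c, nth 0 xs c = r \/ nth 0 [:: y; z] c = r.
    by case: hr => [->|[->|[c e]]]; [exists 0 | exists 1 | exists c]; auto.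
  have [[c1 [c2 [l e /nthy h]]]|[c1 [c2 [l e h]]]] := kw_low pq kw r0 rp hc.
    by left; exists c1; split=> //; lia.
  right; exists c2 => //; case: r r0 {rp hr hc} e h => // r _ /nthy h _; lia.
have xlow c : 0 < c -> nth 0 xs c <= nth 0 xs 1 := kw_xdec kw (c := 1) (c' := c).
have x1p := kw_xle kw 1; have x2p := kw_xle kw 2.
have [/= yle|/= yq] := kw_y_cases 0 kw; last first.
  have [/= zle|/= zq] := kw_y_cases 1 kw; last by constructor 1.
  have [ep|lt] : z = p \/ z < p by lia.
    constructor 2; split=> //; have := kw_disj kw (c := 1); rewrite /= ep; lia.
  have zp : z.+1 = p.
    have [[c [_ h]]|[c e h]] := low z z0 lt (or_intror (or_introl erefl)); first by lia.
    case: (ltnP z.+1 p) => [lt'|]; last by lia.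
    have [[c' [_ h']]|[c' _ h']] :=
      low z.+1 (ltn0Sn z) lt' (or_intror (or_intror (ex_intro _ c e))); lia.
  have x1 : nth 0 xs 1 = p.
    have [[c [_ h]]|[c e h]] := low z z0 lt (or_intror (or_introl erefl)); first by lia.
    by have := xlow c; lia.
  constructor 3; split=> //; have := kw_inv kw (c := 1); rewrite /= x1; lia.
have yp : y < p by have := kw_disj kw (c := 0); rewrite /= x0; lia.
have x2z : z < nth 0 xs 2.
  have /= := kw_inv_right kw (c := 0) (d := 1); rewrite x0; lia.
have ey : y.+1 = p.
  have [[c [_ h]]|[c e h]] := low y y0 yp (or_introl erefl); first by lia.
  case: (ltnP y.+1 p) => [lt'|]; last by lia.
  have [[c' [_ h']]|[c' _ h']] :=
    low y.+1 (ltn0Sn y) lt' (or_intror (or_intror (ex_intro _ c e))); lia.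
have [ez|lt] : z.+1 = p \/ z.+1 < p by lia.
  by constructor 4; left; split=> //; lia.
constructor 4; right; split=> //.
have [[c [_ h]]|[c e h]] := low z z0 (ltnW lt) (or_intror (or_introl erefl)); first by lia.
case: (ltnP z.+1 y) => [lt'|]; last by lia.
have [[c' [e' h']]|[c' _ h']] :=
  low z.+1 (ltn0Sn z) lt (or_intror (or_intror (ex_intro _ c e))); last by lia.
have c0 : c' = 0 by lia.
by rewrite c0 in e'; lia.
Qed.

(** The number of [q]'s in row [q] separates the cases of [kw_y2] up to two pairs, each of which is
    separated by another row. *)
Lemma determined_y2 p q m : 2 < p -> p < q -> 2 < m -> determined p q m 2.
Proof.
move=> p2 pq m2; have p0 : 0 < p by lia.
have hd (xs : seq nat) : size xs = m -> exists x0 x1 x2 s, xs = [:: x0, x1, x2 & s].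
  by case: xs m2 => [|x0 [|x1 [|x2 s]]] /= m2 e; try lia; exists x0, x1, x2, s.
(* Row [p] has two cells in the first case, a [p] and the second [q], but at least three [p]'s in
   the second case. *)
have excl23 xs y z xs' y' z' : size xs = m -> size xs' = m ->
    kohnert_words p q xs [:: y; z] -> kohnert_words p q xs' [:: y'; z'] ->
    same_weight xs [:: y; z] xs' [:: y'; z'] ->
    [/\ y = q, z = p & nth 0 xs 1 < p] ->
    [/\ y' = q, z'.+1 = p, nth 0 xs' 1 = p & nth 0 xs' 2 = p] -> False.
  move=> szx szx' kw kw' sw [ey ez x1] [ey' ez' x1' x2'].
  have sx : 0 < size xs by rewrite szx; lia.
  have sx' : 0 < size xs' by rewrite szx'; lia.
  have := kw_x0 p0 pq sx kw; have := kw_x0 p0 pq sx' kw'; have := sw p.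
  have : count_mem p (behead xs) = 0.
    apply: count_gt => c; rewrite nth_behead.
    exact: leq_ltn_trans (kw_xdec kw (isT : 1 <= c.+1)) x1.
  case: (hd _ szx) x1 => [a0 [a1 [a2 [s ->]]]] /= x1.
  case: (hd _ szx') x1' x2' => [b0 [b1 [b2 [s' ->]]]] /= -> -> h e b0p a0p.
  by rewrite h b0p a0p in e; lia.
(* In the first case row [p - 2] is empty: a [p] there would be weakly left of a [q] in row [p - 1],
   hence in column 1 or 2, where the [p]'s are in row [p]. In the second case a [q] lies in that
   row. *)
have excl45 xs y z xs' y' z' : size xs = m ->
    kohnert_words p q xs [:: y; z] -> kohnert_words p q xs' [:: y'; z'] ->
    same_weight xs [:: y; z] xs' [:: y'; z'] ->
    [/\ y.+1 = p, z.+1 = p & nth 0 xs 2 = p] -> y'.+1 = p /\ z'.+2 = p -> False.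
  move=> szx kw kw' sw [ey ez x2] [ey' ez'].
  have z0 : 0 < z' by lia.
  have zp : z' < p by lia.
  have : z' \in xs.
    by rewrite -has_pred1 has_count; have := sw z'; rewrite /= eqxx; lia.
  case/(nthP 0) => c _ ec.
  have [[c1 [c2 [l h1 h2]]]|[c1 [c2 [_ h1 _]]]] :=
    kw_low pq kw z0 zp (or_introl ec).
    have c12 : c1 <= 2 by case: c2 l h2 => [|[|c2]] /=; rewrite ?nth_nil //; lia.
    by have := kw_xdec kw c12; lia.
  by case: c1 h1 => [|[|c1]] /=; rewrite ?nth_nil; lia.
move=> xs [|y [|z []]] // xs' [|y' [|z' []]] // szx _ szx' _ kw kw' sw.
apply: (same_weight_y kw kw' sw).
have := sw q; rewrite (kw_count_q pq kw) (kw_count_q pq kw') /= => e.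
have sw' : same_weight xs' [:: y'; z'] xs [:: y; z] by move=> r; rewrite sw.
have sx : 0 < size xs by rewrite szx; lia.
have sx' : 0 < size xs' by rewrite szx'; lia.
suff [-> ->] : y = y' /\ z = z' by [].
have h := kw_y2 p0 pq sx kw; have h' := kw_y2 p0 pq sx' kw'.
have h23 := excl23 _ _ _ _ _ _ szx szx' kw kw' sw.
have h32 := excl23 _ _ _ _ _ _ szx' szx kw' kw sw'.
have h45 := excl45 _ _ _ _ _ _ szx kw kw' sw.
have h54 := excl45 _ _ _ _ _ _ szx' kw' kw sw'.
by case: h => [h|h|h|[h|h]]; case: h' => [h'|h'|h'|[h'|h']]; try (by case: (h23 h h')); try (by case: (h32 h' h));
  try (by case: (h45 h h')); try (by case: (h54 h' h)); case: h; case: h'; clear -pq e; lia.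
Qed.

(** * Depth bounds *)

(** Otherwise row [r + 1 < p] has a [q] weakly right of the [p] in row [r], and a [q] with a [p] of
    row [r + 2] weakly to its right. The latter gives an inversion; it persists to the column of the
    [p] in row [r] and forces a [p] above row [r] in the next column, against descent. *)
Lemma kw_gapless p q xs ys r : 0 < p -> p < q -> kohnert_words p q xs ys ->
  0 < r -> r < p -> r \in xs -> r.+1 \in xs.
Proof.
move=> p0 pq kw r0 rp rx.
have sx : 0 < size xs by case: (xs) rx.
have x0 := kw_x0 p0 pq sx kw.
have mem c k : nth 0 xs c = k.+1 -> k.+1 \in xs.
  by move=> e; rewrite -e; apply: mem_nth; rewrite -nth_word_pos ?e // (kw_xpos kw).
case/(nthP 0): rx => c _ ec.
have [[c1 [c2 [l h1 h2]]]|[_ [c2 [_ _ /mem //]]]] :=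
  kw_low pq kw r0 rp (or_introl ec).
have [e|lt] : r.+1 = p \/ r.+1 < p by lia.
  by apply: (mem 0); rewrite x0.
have [[d1 [_ [_ /mem //]]]|[d1 [d2 [l' h3 h4]]]] :=
  kw_low pq kw (ltn0Sn r) lt (or_intror h2).
have lt2 : d2 < c1.
  by rewrite ltnNge; apply/negP => le; have := kw_xdec kw le; lia.
have inv : nth 0 ys d1 < nth 0 xs d1 by have := kw_xdec kw l'; lia.
have le1 : d1 <= c1 by lia.
have := kw_inv_right kw inv le1; have := kw_ydec kw l.
by have := kw_xdec kw (leqnSn c1); lia.
Qed.

Lemma kw_x_depth p q xs ys r : 0 < p -> p < q -> kohnert_words p q xs ys ->
  r \in xs -> p < r + size xs.
Proof.
move=> p0 pq kw rx; have r0 : 0 < r.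
  by rewrite lt0n; apply: contra (kw_xpos kw) => /eqP <-.
case: (ltnP p r) => [|le]; first by lia.
have all_in k : r + k <= p -> r + k \in xs.
  elim: k => [|k IH]; rewrite ?addn0 // addnS => h.
  by apply: (kw_gapless p0 pq kw) => //; [lia | apply: IH; lia].
have : size (iota r (p - r).+1) <= size xs.
  apply: uniq_leq_size; first exact: iota_uniq.
  move=> k; rewrite mem_iota => h; have -> : k = r + (k - r) by lia.
  by apply: all_in; lia.
by rewrite size_iota; lia.
Qed.

(** A [q] below row [p] has a [p] in its own row or just above, so the [q]'s reach at most one row
    deeper than [kw_x_depth] allows the [p]'s. *)
Lemma kw_y_depth p q xs ys r : 0 < p -> p < q -> 0 < size xs ->
  kohnert_words p q xs ys -> r \in ys -> p <= r + size xs.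
Proof.
move=> p0 pq sx kw ry; have r0 : 0 < r.
  by rewrite lt0n; apply: contra (kw_ypos kw) => /eqP <-.
case: (ltnP r p) => [lt|]; last by lia.
have mem c k : nth 0 xs c = k.+1 -> k.+1 \in xs.
  by move=> e; rewrite -e; apply: mem_nth; rewrite -nth_word_pos ?e // (kw_xpos kw).
case/(nthP 0): ry => c _ ec.
have [[c1 [_ [_ h _]]]|[_ [c2 [_ _ /mem h]]]] :=
  kw_low pq kw r0 lt (or_intror ec).
  by case: r r0 h {lt ec} => // r _ /mem /(kw_x_depth p0 pq kw); lia.
by have := kw_x_depth p0 pq kw h; lia.
Qed.

(** * Enumeration of the three sporadic shapes *)

(* Rows are coded relative to [p], so that the code does not depend on [p] and
   [q]: [i] stands for row [p - i] in a word of [p]'s, while in a word of [q]'s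
   [0] stands for row [q] and [i.+1] for row [p - i]. *)
Definition xcode (p : nat) (xs : seq nat) : seq nat := [seq p - x | x <- xs].

Definition ycode (p q : nat) (ys : seq nat) : seq nat :=
  [seq if y == q then 0 else (p - y).+1 | y <- ys].

(** These are consequences of [kohnert_words] free of [p] and [q]: column 1, disjointness with
    inversions, and [kw_low] for row [p - i.+1]. The bounds [c.+1 < size u] and [c2 < size u] keep
    the default [0] from being read as row [p]. Positivity of rows is dropped, so one finite check
    covers every [p]. *)
Definition good_code (u v : seq nat) : bool :=
  let columns := iota 0 (maxn (size u) (size v)) in
  [&& nth 0 u 0 == 0,
    all (fun c => (nth 0 v c != (nth 0 u c).+1) &&
        (((nth 0 u c).+1 < nth 0 v c) ==>
          (c.+1 < size u) && ((nth 0 u c.+1).+1 < nth 0 v c)))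
      (iota 0 (minn (size u) (size v))) &
    all (fun i => (i.+1 \in u) || (i.+2 \in v) ==>
        has (fun c1 => has (fun c2 => (c1 <= c2) &&
          ((nth 0 u c1 == i.+1) && (nth 0 v c2 == i.+1) ||
           [&& nth 0 v c1 == i.+2, c2 < size u & nth 0 u c2 == i]))
          columns) columns)
      (iota 0 (size u))].

Fixpoint words (k d : nat) : seq (seq nat) :=
  if k is k'.+1 then [seq i :: w | i <- iota 0 d, w <- words k' d] else [:: [::]].

(** Row [q] comes first, then rows [p] down to [p - m] with [m] the number of [p]'s, the deepest row
    allowed by the depth bounds. *)
Definition code_weight (w : seq nat * seq nat) : seq nat :=
  count_mem 0 w.2 ::
  [seq count_mem i w.1 + count_mem i.+1 w.2 | i <- iota 0 (size w.1).+1].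

(** The alphabet sizes [m] and [m.+2] come from [kw_x_depth] and [kw_y_depth]; descending rows have
    increasing codes. *)
Definition good_codes (m n : nat) : seq (seq nat * seq nat) :=
  [seq w <- [seq (u, v) | u <- [seq u <- words m m | sorted leq u],
                          v <- [seq v <- words n m.+2 | sorted leq v]] |
    good_code w.1 w.2].

(** Comparing first components suffices, by [same_weight_x]. *)
Definition codes_determined (m n : nat) : bool :=
  let L := good_codes m n in
  all (fun w => all (fun w' => (code_weight w == code_weight w') ==>
    (w.1 == w'.1)) L) L.

Lemma codes_determined_small :
  [&& codes_determined 3 3, codes_determined 4 4 & codes_determined 4 3].
Proof. by vm_compute. Qed.

Lemma mem_words k d w : size w = k -> all (fun i => i < d) w -> w \in words k d.
Proof.
elim: k w => [|k IH] [|i w] //= [sz] /andP[lt h].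
by apply/allpairsP; exists (i, w); rewrite mem_iota /= lt IH.
Qed.

Lemma xcode_inj p xs xs' : (forall c, nth 0 xs c <= p) ->
  (forall c, nth 0 xs' c <= p) -> xcode p xs = xcode p xs' -> xs = xs'.
Proof.
have K s : (forall c, nth 0 s c <= p) -> [seq p - x | x <- xcode p s] = s.
  move=> h; rewrite -map_comp; apply: map_id_in => x /(nthP 0) [c _ <-] /=.
  by rewrite subKn.
by move=> h h' e; rewrite -(K xs h) e K.
Qed.

Lemma xcode_nth p xs c : c < size xs -> nth 0 (xcode p xs) c = p - nth 0 xs c.
Proof. by move=> lt; rewrite (nth_map 0). Qed.

Lemma ycode_nth p q ys c : c < size ys -> nth 0 (ycode p q ys) c =
  if nth 0 ys c == q then 0 else (p - nth 0 ys c).+1.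
Proof. by move=> lt; rewrite (nth_map 0). Qed.

Lemma good_code_of_words p q xs ys : 0 < p -> p < q -> 0 < size xs ->
  kohnert_words p q xs ys -> good_code (xcode p xs) (ycode p q ys).
Proof.
move=> p0 pq sx kw; rewrite /good_code !size_map.
have xin c : 0 < nth 0 xs c -> c < size xs by rewrite nth_word_pos // (kw_xpos kw).
have yin c : 0 < nth 0 ys c -> c < size ys by rewrite nth_word_pos // (kw_ypos kw).
have xpos c : c < size xs -> 0 < nth 0 xs c by rewrite nth_word_pos // (kw_xpos kw).
have ypos c : c < size ys -> 0 < nth 0 ys c by rewrite nth_word_pos // (kw_ypos kw).
apply/and3P; split; [|apply/allP|apply/allP].
- by rewrite xcode_nth // (kw_x0 p0 pq sx kw) subnn.
- move=> c; rewrite mem_iota add0n leq_min => /andP[_ /andP[ltx lty]].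
  rewrite xcode_nth // ycode_nth //.
  have := kw_y_cases c kw; have := kw_xle kw c; have := kw_xle kw c.+1.
  have := xpos c ltx; have := ypos c lty; have := kw_disj kw (c := c).
  have := kw_inv kw (c := c); have := xin c.+1; have := @xcode_nth p xs c.+1.
  case: (nth 0 ys c =P q) => [_|ne]; first by move=> *; rewrite ltn0.
  move=> hn hin hinv hdisj hy hx le1 le [hyp|//].
  apply/andP; split; first by apply/eqP => e; lia.
  apply/implyP => lt; have h := hinv hy ltac:(lia).
  by have lt' := hin ltac:(lia); rewrite lt' hn //; lia.
move=> i _; apply/implyP => /orP h.
have [r [r0 rp er hr]] : exists r, [/\ 0 < r, r < p, p - r = i.+1 &
    exists c, nth 0 xs c = r \/ nth 0 ys c = r].
  case: h => /mapP [r hr er]; exists r.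
    have r0 : 0 < r by rewrite lt0n; apply: contra (kw_xpos kw) => /eqP <-.
    split=> //; first by lia.
    by case/(nthP 0): hr => c _ <-; exists c; left.
  have r0 : 0 < r by rewrite lt0n; apply: contra (kw_ypos kw) => /eqP <-.
  case: eqP er => // ne er; split=> //; [by lia | by lia |].
  by case/(nthP 0): hr => c _ <-; exists c; right.
case: hr => c hc.
have colx c' k : nth 0 xs c' = k -> 0 < k ->
    c' < size xs /\ c' \in iota 0 (maxn (size xs) (size ys)).
  by move=> e k0; have lt := xin c'; rewrite e in lt; split; [exact: lt|];
    rewrite mem_iota add0n leq_max lt.
have coly c' k : nth 0 ys c' = k -> 0 < k ->
    c' < size ys /\ c' \in iota 0 (maxn (size xs) (size ys)).
  by move=> e k0; have lt := yin c'; rewrite e in lt; split; [exact: lt|];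
    rewrite mem_iota add0n leq_max lt ?orbT.
have [[c1 [c2 [l h1 h2]]]|[c1 [c2 [l h1 h2]]]] := kw_low pq kw r0 rp hc.
  have [lt1 in1] := colx _ _ h1 r0; have [lt2 in2] := coly _ _ h2 (ltn0Sn r).
  apply/hasP; exists c1 => //; apply/hasP; exists c2 => //.
  rewrite l xcode_nth // ycode_nth // h1 h2 er eqxx ifF /=; last by lia.
  by apply/orP; left; apply/eqP; lia.
have [lt1 in1] := coly _ _ h1 r0; have [lt2 in2] := colx _ _ h2 (ltn0Sn r).
apply/hasP; exists c1 => //; apply/hasP; exists c2 => //.
rewrite l lt2 (ycode_nth _ _ lt1) (xcode_nth _ lt2) h1 h2 er ifF; last by lia.
by apply/orP; right; rewrite eqxx /=; apply/eqP; lia.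
Qed.

Lemma good_codes_of_words p q xs ys : 0 < p -> p < q -> 0 < size xs ->
  kohnert_words p q xs ys ->
  (xcode p xs, ycode p q ys) \in good_codes (size xs) (size ys).
Proof.
move=> p0 pq sx kw; rewrite mem_filter good_code_of_words //=.
apply/allpairsP; exists (xcode p xs, ycode p q ys); rewrite !mem_filter /=.
split=> //; apply/andP; split.
- apply/(sortedP 0) => c; rewrite size_map => lt.
  rewrite !xcode_nth //; last exact: ltnW.
  exact: leq_sub2l (kw_xdec kw (leqnSn c)).
- apply: mem_words; rewrite ?size_map // all_map; apply/allP => r hr /=.
  by have := kw_x_depth p0 pq kw hr; lia.
- apply/(sortedP 0) => c; rewrite size_map => lt.
  rewrite !ycode_nth //; last exact: ltnW.
  have := kw_ydec kw (leqnSn c); have := kw_y_cases c kw.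
  by have := kw_y_cases c.+1 kw; do 2!case: eqP; lia.
- apply: mem_words; rewrite ?size_map // all_map; apply/allP => r hr /=.
  by have := kw_y_depth p0 pq sx kw hr; case: eqP; lia.
Qed.

Lemma code_weightE p q xs ys : 0 < p -> p < q -> kohnert_words p q xs ys ->
  code_weight (xcode p xs, ycode p q ys) = count_mem q xs + count_mem q ys ::
    [seq if i < p then count_mem (p - i) xs + count_mem (p - i) ys else 0
    | i <- iota 0 (size xs).+1].
Proof.
move=> p0 pq kw; rewrite /code_weight (kw_count_q pq kw) add0n.
have -> : size (xcode p xs, ycode p q ys).1 = size xs by rewrite size_map.
have xr x : x \in xs -> 0 < x <= p.
  case/(nthP 0) => c lt <-; rewrite (kw_xle kw) andbT.
  by rewrite nth_word_pos // (kw_xpos kw).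
have yr y : y \in ys -> 0 < y /\ (y <= p \/ y = q).
  case/(nthP 0) => c lt <-; split; last exact: kw_y_cases kw.
  by rewrite nth_word_pos // (kw_ypos kw).
congr (_ :: _).
  by rewrite count_map; apply: eq_count => y /=; case: (y =P q).
apply: eq_map => i; rewrite !count_map; case: ltnP => ip.
  congr (_ + _); apply: eq_in_count => r hr /=.
    by have := xr r hr; lia.
  by have := yr r hr; case: (r =P q); lia.
rewrite !(eq_in_count (a2 := pred0)) ?count_pred0 // => r hr /=.
  by have := xr r hr; lia.
by have := yr r hr; case: (r =P q); lia.
Qed.

Lemma determined_codes p q m n : 0 < p -> p < q -> 0 < m ->
  codes_determined m n -> determined p q m n.
Proof.
move=> p0 pq m0 /allP det xs ys xs' ys' szx szy szx' szy' kw kw' sw.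
apply: (same_weight_x kw kw' sw).
apply: (xcode_inj (kw_xle kw) (kw_xle kw')).
have sx : 0 < size xs by rewrite szx.
have sx' : 0 < size xs' by rewrite szx'.
have := good_codes_of_words p0 pq sx kw; have := good_codes_of_words p0 pq sx' kw'.
rewrite szx szy szx' szy' => h' /det /allP /(_ _ h') /implyP h.
apply/eqP; apply: h; rewrite !(code_weightE p0 pq) // szx szx' sw.
by apply/eqP; congr (_ :: _); apply: eq_map => i; rewrite sw.
Qed.

(** * Pairs of equal weight in the other shapes *)

Definition blocks (p a b c : nat) : seq nat :=
  nseq a p ++ nseq b p.-1 ++ nseq c p.-2.

Lemma size_blocks p a b c : size (blocks p a b c) = a + b + c.
Proof. by rewrite !size_cat !size_nseq addnA. Qed.

Lemma nth_blocks p a b c i : let v := nth 0 (blocks p a b c) i in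
  (i < a /\ v = p) \/ (a <= i < a + b /\ v = p.-1) \/
  (a + b <= i < a + b + c /\ v = p.-2) \/ (a + b + c <= i /\ v = 0).
Proof.
rewrite /blocks /= !nth_cat !size_nseq !nth_nseq.
case: ltnP => h1; first by lia.
case: ltnP => h2; first by lia.
case: ltnP => h3; lia.
Qed.

Lemma nth_blocks_q p q k a b c i : let v := nth 0 (nseq k q ++ blocks p a b c) i in
  (i < k /\ v = q) \/ (k <= i < k + a /\ v = p) \/
  (k + a <= i < k + a + b /\ v = p.-1) \/
  (k + a + b <= i < k + a + b + c /\ v = p.-2) \/ (k + a + b + c <= i /\ v = 0).
Proof.
rewrite /= nth_cat size_nseq; case: ltnP => h; first by rewrite nth_nseq h; left.
by have := nth_blocks p a b c (i - k); rewrite /=; lia.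
Qed.

Lemma count_blocks p a b c r : count_mem r (blocks p a b c) =
  (p == r) * a + (p.-1 == r) * b + (p.-2 == r) * c.
Proof. by rewrite !count_cat !count_nseq /= addnA. Qed.

(* The first alternative describes fillings without inversions, the second one
   those in which every column with a [q] outside row [q] has an inversion. *)
Definition block_condition (k a b c d e f : nat) : Prop :=
  [/\ a <= k, a + b <= k + d, 0 < b, 0 < d & f = 0 /\ (0 < c -> 0 < e)] \/
  [/\ d = 0, k + e < a, k + e + f < a + b, 0 < e & 0 < b /\ 0 < f].

Lemma block_words p q k a b c d e f : 2 < p -> p < q -> 0 < a ->
  block_condition k a b c d e f ->
  kohnert_words p q (blocks p a b c) (nseq k q ++ blocks p d e f).
Proof.
move=> p2 pq a0 cond.
have X := nth_blocks p a b c; have Y := nth_blocks_q p q k d e f.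
have {}cond : (a <= k /\ a + b <= k + d /\ 0 < b /\ 0 < d /\ f = 0 /\ (c = 0 \/ 0 < e)) \/
    (d = 0 /\ k + e < a /\ k + e + f < a + b /\ 0 < e /\ 0 < b /\ 0 < f).
  case: cond => [[h1 h2 h3 h4 [h5 h6]]|[]]; [left | by right].
  by do 5!split=> //; case: (posnP c); auto.
split.
- by apply/negP => /(nthP 0) [i]; rewrite size_blocks => lt; have := X i; rewrite /=; lia.
- apply/negP => /(nthP 0) [i]; rewrite size_cat size_nseq size_blocks => lt.
  by have := Y i; rewrite /=; lia.
- by move=> i; have := X i; rewrite /=; lia.
- by move=> i; have := Y i; rewrite /=; lia.
- by move=> i j le; have := X i; have := X j; rewrite /=; lia.
- by move=> i j le; have := Y i; have := Y j; rewrite /=; lia.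
- by move=> i; have := X i; have := Y i; rewrite /=; lia.
- by move=> i; have := X i; have := X i.+1; have := Y i; rewrite /=; lia.
- move=> r i r0 hr.
  have x0 : nth 0 (blocks p a b c) 0 = p by have := X 0; rewrite /=; lia.
  have [e1|[[e1 ?]|[e1|[e1 ?]]]] : r = p \/ (r = q /\ 0 < k) \/ r = p.-1 \/ (r = p.-2 /\ (0 < c \/ 0 < f)).
    by have := X i; have := Y i; rewrite /=; lia.
  + by constructor 1; split=> //; exists 0.
  + by constructor 2; split=> //; exists 0; have := Y 0; rewrite /=; lia.
  (* Without inversions, the first [p] in row [p - 1] and the first [q] in row [p]; with inversions,
     the first [q] in row [p - 1] and the [p] of row [p] in its column. *)
  + constructor 3; case: cond => h; [exists a, k | exists k, k]; split; try lia.
    * by left; have := X a; rewrite /=; lia.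
    * by right; have := Y k; rewrite /=; lia.
    * by right; have := Y k; rewrite /=; lia.
    * by left; have := X k; rewrite /=; lia.
  (* The same one row lower: first [p] in row [p - 2] and first [q] in row [p - 1], or first [q] in
     row [p - 2] and first [p] in row [p - 1]. *)
  + constructor 3; case: cond => h; [exists (a + b), (k + d) | exists (k + e), a].
    * split; [lia | left | right].
        by have := X (a + b); rewrite /=; lia.
      by have := Y (k + d); rewrite /=; lia.
    * split; [lia | right | left].
        by have := Y (k + e); rewrite /=; lia.
      by have := X a; rewrite /=; lia.
Qed.

Lemma not_determined p q m n k a b c d e f k' a' b' c' d' e' f' :
  2 < p -> p < q -> 0 < a -> 0 < a' ->
  block_condition k a b c d e f -> block_condition k' a' b' c' d' e' f' ->
  a + b + c = m -> a' + b' + c' = m ->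
  k + d + e + f = n -> k' + d' + e' + f' = n ->
  k = k' -> a + d = a' + d' -> b + e = b' + e' -> c + f = c' + f' ->
  a != a' \/ b != b' -> ~ determined p q m n.
Proof.
move=> p2 pq a0 a0' h h' szx szx' szy szy' ek w0 w1 w2 ne det.
have kw := block_words p2 pq a0 h; have kw' := block_words p2 pq a0' h'.
have [||||r|ex _] := det _ _ _ _ _ _ _ _ kw kw'.
- by rewrite size_blocks.
- by rewrite size_cat size_nseq size_blocks !addnA.
- by rewrite size_blocks.
- by rewrite size_cat size_nseq size_blocks !addnA.
- rewrite (count_cat _ (nseq k q)) (count_cat _ (nseq k' q)).
  rewrite !count_blocks !count_nseq ek /=.
  by case: (p == r); case: (p.-1 == r); case: (p.-2 == r); rewrite ?mul1n ?mul0n; lia.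
have := congr1 (count_mem p) ex; have := congr1 (count_mem p.-1) ex.
rewrite !count_blocks !eqxx.
have -> : (p == p.-1) = false by lia.
have -> : (p.-1 == p) = false by lia.
have -> : (p.-2 == p) = false by lia.
have -> : (p.-2 == p.-1) = false by lia.
by lia.
Qed.

(** * Classification of the shapes *)

Lemma determined_shape p q m n : 2 < p -> p < q -> 0 < m -> 0 < n ->
  determined p q m n <->
  [|| m <= 2, n <= 2 | (m, n) \in [:: (3, 3); (4, 4); (4, 3)]].
Proof.
move=> p2 pq m0 n0; have p0 : 0 < p by lia.
split=> [det|].
  apply/negPn/negP; rewrite !inE !xpair_eqE => h.
  have cases : (2 < m < n \/ m = n /\ 4 < n) \/ (m = n.+1 /\ 3 < n \/ n.+1 < m /\ 2 < n) by lia.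
  case: cases => [[h1|[h1 h2]]|[[h1 h2]|[h1 h2]]]; move: det.
  (* Without inversions: a [p] and a [q] trade places between rows [p] and [p - 1]. *)
  - apply: (@not_determined p q m n (n - 2) (m - 2) 2 0 2 0 0 (n - 2) (m - 1) 1 0 1 1 0) => //;
      rewrite ?/block_condition; try (by left; split; lia); lia.
  (* The same exchange, with two [p]'s sent to row [p - 2] because equal lengths leave too few [q]'s
     in row [q]; [2 <= m - 3] needs [m] at least 5. *)
  - apply: (@not_determined p q m n (m - 3) 1 (m - 3) 2 2 1 0 (m - 3) 2 (m - 4) 2 1 2 0) => //;
      rewrite ?/block_condition; try (by left; split; lia); lia.
  (* A filling with inversions against one without; [n - 3] must be positive. *)
  - apply: (@not_determined p q m n 1 (n - 1) 2 0 0 (n - 3) 2 1 1 (n - 2) 2 (n - 2) 1 0) => //;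
      rewrite ?/block_condition; try (by left; split; lia); try (by right; split; lia); lia.
  (* Both with inversions: a [p] and a [q] trade places between rows [p - 1] and [p - 2]. The second
     filling needs [n - 1 < m - 2]. *)
  - apply: (@not_determined p q m n 0 (m - 2) 2 0 0 (n - 2) 2 0 (m - 2) 1 1 0 (n - 1) 1) => //;
      rewrite ?/block_condition; try (by left; split; lia); try (by right; split; lia); lia.
have [m1|m2] : m = 1 \/ 1 < m by lia.
  by rewrite m1 => _; apply: determined_x1.
have [n1|n2] : n = 1 \/ 1 < n by lia.
  by rewrite n1 => _; apply: determined_y1.
have [m2'|m3] : m = 2 \/ 2 < m by lia.
  by rewrite m2' => _; apply: determined_x2 => //; lia.
have [n2'|n3] : n = 2 \/ 2 < n by lia.
  by rewrite n2' => _; apply: determined_y2.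
have /and3P[d33 d44 d43] := codes_determined_small.
case/or3P => [|| hmn]; [by lia | by lia |]; move: hmn; rewrite !inE.
by case/or3P => /eqP [-> ->]; apply: determined_codes.
Qed.

Lemma sort_two m n : sort geq [:: m; n] = if n <= m then [:: m; n] else [:: n; m].
Proof. by rewrite /sort /=; case: ifP. Qed.

Theorem theorem5p4 (a : weak_composition)
    (two_nonzero_parts : size (flat a) = 2)
    (leading_zeros : part a 1 = 0 /\ part a 2 = 0) :
  key_multiplicity_free a <->
  ((sort_parts a = [:: 3; 3] \/
    sort_parts a = [:: 4; 4] \/
    (exists n, 4 <= n /\ sort_parts a = [:: n - 2; 2]) \/
    (exists n, 2 <= n /\ sort_parts a = [:: n - 1; 1])) \/
   flat a = [:: 4; 3]).
Proof.
have [z1 z2] := leading_zeros.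
have [p [q [[p2 pq qa] [m0 n0 ea a0]]]] := two_parts two_nonzero_parts z1 z2.
have p0 : 0 < p by lia.
rewrite (mult_free_words p0 pq qa a0) -/(determined p q _ _).
rewrite determined_shape // /sort_parts ea sort_two !inE !xpair_eqE.
move: (part a p) (part a q) m0 n0 => m n m0 n0.
split=> [h|].
  have [m1|[n1|[[m2 n2]|[[n2 m2]|[[m3 n3]|[[m4 n4]|[m4 n3]]]]]]] :
      m = 1 \/ n = 1 \/ (m = 2 /\ 1 < n) \/ (n = 2 /\ 1 < m) \/
      (m = 3 /\ n = 3) \/ (m = 4 /\ n = 4) \/ (m = 4 /\ n = 3).
    by move: h; lia.
  (* In this case and the next three, the witness is the sum of the two parts. *)
  - left; right; right; right; exists n.+1; rewrite m1 subn1 /=.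
    by split=> //; case: leqP => // h1; congr [:: _; _]; lia.
  - left; right; right; right; exists m.+1; rewrite n1 subn1 /=.
    by rewrite m0; split.
  - left; right; right; left; exists n.+2; rewrite m2 subn2 /=.
    by split=> //; case: leqP => // h1; congr [:: _; _]; lia.
  - left; right; right; left; exists m.+2; rewrite n2 subn2 /=.
    by rewrite m2; split.
  - by left; left; rewrite m3 n3.
  - by left; right; left; rewrite m4 n4.
  - by right; rewrite m4 n3.
case=> [[|[|[[k [hk]]|[k [hk]]]]]|]; try case: ifP => _.
all: by case; lia.
Qed.
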